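(* Let $\mathcal A$ denote the sampling-with-replacement NISPP method, in which each batch $\mathbf B_k$ is chosen uniformly at random from the subsets of $\mathbf S$ of a given size $B_k$. Then $\mathcal A$ satisfies the uniform argument stability bound $$\sup_{\mathbf S\simeq\mathbf S'}\mathbb E_{\mathcal A}[\delta_{\mathcal A}(\mathbf S,\mathbf S')]\le\sum_{k=1}^K\Big(\frac{2M}{n\lambda_k}+\sqrt{\frac{4\nu}{\lambda_k}}\Big).$$ Furthermore, if $|\mathbf B_k|=B$ and $\lambda_k=\lambda$ for all $k$, then with probability at least $1-n\exp\{-KB/[4n]\}$ (over both sampling and noise addition), $$\sup_{\mathbf S\simeq\mathbf S'}\delta_{\mathcal A}(\mathbf S,\mathbf S')\le\frac{4MK}{\lambda n}+K\sqrt{\frac{4\nu}{\lambda}}.$$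
   Context: $\mathcal W\subseteq\mathbb R^d$ is compact convex with diameter $D>0$; $\|\cdot\|$ is the Euclidean norm and $\Pi_{\mathcal W}$ the Euclidean projection. For every $\beta\in\mathcal Z$, $F_\beta:\mathcal W\to\mathbb R^d$ is monotone ($\langle F_\beta(w_1)-F_\beta(w_2),w_1-w_2\rangle\ge0$), $L$-Lipschitz and $M$-bounded ($\sup_{\mathcal W}\|F_\beta\|\le M$). For a finite batch $\mathbf B$, $F_{\mathbf B}=\frac1{|\mathbf B|}\sum_{\beta\in\mathbf B}F_\beta$. Data sets $\mathbf S,\mathbf S'\in\mathcal Z^n$ are neighbors ($\mathbf S\simeq\mathbf S'$) if they differ in at most one entry. NISPP method, with parameters $\lambda_k>0$, $\gamma_k>0$, $\nu\ge0$, $\sigma_{k+1}\ge0$: from $w_0\in\mathcal W$ (the same for all data sets), for $k=0,1,\dots,K$: take a batch $\mathbf B_{k+1}\subseteq\mathbf S$; compute $u_{k+1}\in\mathcal W$ with $\langle F_{\mathbf B_{k+1}}(u_{k+1})+\lambda_k(u_{k+1}-w_k),w-u_{k+1}\rangle\ge-\nu$ for all $w\in\mathcal W$; set $w_{k+1}=u_{k+1}+\xi_{k+1}$ with independent $\xi_{k+1}\sim\mathcal N(0,\sigma_{k+1}^2\mathbb I_d)$. Output $\mathcal A(\mathbf S)=\Pi_{\mathcal W}(\bar w_K)$, $\bar w_K=\big(\sum_{k=0}^K\gamma_kw_{k+1}\big)/\big(\sum_{k=0}^K\gamma_k\big)$. $\delta_{\mathcal A}(\mathbf S,\mathbf S')=\|\mathcal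 A(\mathbf S)-\mathcal A(\mathbf S')\|$, where the two runs share the same internal randomness (noise, and positions of the sampled data points); $\mathbb E_{\mathcal A}$ is expectation over this randomness.
   Formalization: The method is taken to run K ≥ 1 steps numbered 1,…,K (parameters λ_k, γ_k, batches B_k), instead of K+1 steps k=0,…,K; with K+1 steps the K-term expectation bound is false. *)

(* Defs.v *)
From HB Require Import structures.
From mathcomp Require Import all_boot all_order all_algebra.
From mathcomp Require Import all_classical all_reals all_analysis.

Set Implicit Arguments.
Unset Strict Implicit.
Unset Printing Implicit Defensive.

Import Order.TTheory GRing.Theory Num.Theory.
Import numFieldNormedType.Exports.

Local Open Scope classical_set_scope.
Local Open Scope ring_scope.

(* The library norm on 'rV[R]_d is the sup norm, hence the explicit Euclidean
   inner product and norm.  The topology of 'rV[R]_d is the usual one. *)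

Definition dot (R : realType) (d : nat) (u v : 'rV[R]_d) : R :=
  \sum_(j < d) u 0 j * v 0 j.

Definition enorm (R : realType) (d : nat) (u : 'rV[R]_d) : R :=
  Num.sqrt (dot u u).

Definition diameter (R : realType) (d : nat) (W : set 'rV[R]_d) : R :=
  sup [set r | exists x y, [/\ W x, W y & r = enorm (x - y)]].

(* The default value 0 of xget is irrelevant when W is nonempty, closed and
   convex: the nearest point then exists and is unique. *)
Definition eproj (R : realType) (d : nat) (W : set 'rV[R]_d) (x : 'rV[R]_d)
    : 'rV[R]_d :=
  xget 0 [set y | W y /\ forall z, W z -> enorm (x - y) <= enorm (x - z)].

(* Operators W -> R^d are total functions constrained on W only. *)

Definition emonotone_on (R : realType) (d : nat) (W : set 'rV[R]_d)
    (f : 'rV[R]_d -> 'rV[R]_d) : Prop :=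
  forall x y, W x -> W y -> 0 <= dot (f x - f y) (x - y).

Definition elipschitz_on (R : realType) (d : nat) (W : set 'rV[R]_d) (L : R)
    (f : 'rV[R]_d -> 'rV[R]_d) : Prop :=
  forall x y, W x -> W y -> enorm (f x - f y) <= L * enorm (x - y).

Definition ebounded_on (R : realType) (d : nat) (W : set 'rV[R]_d) (M : R)
    (f : 'rV[R]_d -> 'rV[R]_d) : Prop :=
  forall x, W x -> enorm (f x) <= M.

Definition neighbors (Z : Type) (n : nat) (S S' : n.-tuple Z) : Prop :=
  exists i : 'I_n, forall j : 'I_n, j != i -> tnth S j = tnth S' j.

(* A batch is given by the set J of the positions of its elements in the data
   set S, so that it keeps its meaning when S is replaced by a neighbor and
   when S has repeated entries. *)
Definition batch_op (R : realType) (d : nat) (Z : Type) (n : nat)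
    (F : Z -> 'rV[R]_d -> 'rV[R]_d) (S : n.-tuple Z) (J : {set 'I_n})
    (u : 'rV[R]_d) : 'rV[R]_d :=
  (#|J|%:R)^-1 *: \sum_(i in J) F (tnth S i) u.

(* u is a nu-approximate solution in W of the strongly monotone variational
   inequality with operator f + lambda (. - w). *)
Definition prox_sol (R : realType) (d : nat) (W : set 'rV[R]_d)
    (f : 'rV[R]_d -> 'rV[R]_d) (lambda nu : R) (w u : 'rV[R]_d) : Prop :=
  W u /\ forall v, W v -> - nu <= dot (f u + lambda *: (u - w)) (v - u).

(* solve k S J w is the point that the subproblem solver returns at step k, on
   data set S, batch positions J and current iterate w.  The steps are numbered
   1, ..., K: step k uses the batch, regularization, weight and noise of index
   k and turns w_(k-1) into w_k. *)
Fixpoint nispp_iter (R : realType) (d : nat) (Z : Type) (n : nat)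
    (solve : nat -> n.-tuple Z -> {set 'I_n} -> 'rV[R]_d -> 'rV[R]_d)
    (w0 : 'rV[R]_d) (J : nat -> {set 'I_n}) (xi : nat -> 'rV[R]_d)
    (S : n.-tuple Z) (k : nat) : 'rV[R]_d :=
  match k with
  | 0 => w0
  | k'.+1 =>
      solve k'.+1 S (J k'.+1) (nispp_iter solve w0 J xi S k') + xi k'.+1
  end.

Definition nispp (R : realType) (d : nat) (Z : Type) (n : nat)
    (W : set 'rV[R]_d)
    (solve : nat -> n.-tuple Z -> {set 'I_n} -> 'rV[R]_d -> 'rV[R]_d)
    (w0 : 'rV[R]_d) (gamma : nat -> R) (K : nat)
    (J : nat -> {set 'I_n}) (xi : nat -> 'rV[R]_d) (S : n.-tuple Z)
    : 'rV[R]_d :=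
  eproj W ((\sum_(1 <= k < K.+1) gamma k)^-1 *:
           \sum_(1 <= k < K.+1) gamma k *: nispp_iter solve w0 J xi S k).

Definition nispp_dist (R : realType) (d : nat) (Z : Type) (n : nat)
    (W : set 'rV[R]_d)
    (solve : nat -> n.-tuple Z -> {set 'I_n} -> 'rV[R]_d -> 'rV[R]_d)
    (w0 : 'rV[R]_d) (gamma : nat -> R) (K : nat)
    (J : nat -> {set 'I_n}) (xi : nat -> 'rV[R]_d) (S S' : n.-tuple Z) : R :=
  enorm (nispp W solve w0 gamma K J xi S - nispp W solve w0 gamma K J xi S').

(* normal_prob 0 0 is not the degenerate law in the library. *)
Definition centered_normal (R : realType) (s : R) (U : set R) : \bar R :=
  if s == 0 then \d_(0 : R) U else normal_prob 0 s U.

(* Mutual independence of the classes of events G i. *)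
Definition mutually_independent (R : realType) (dO : measure_display)
    (Omega : measurableType dO) (P : probability Omega R)
    (I : finType) (G : I -> set (set Omega)) : Prop :=
  forall (A : {set I}) (E : I -> set Omega),
    (forall i, i \in A -> G i (E i)) ->
    P (\bigcap_(i in [set i | i \in A]) E i) = (\prod_(i in A) P (E i))%E.

Definition uniform_batch (R : realType) (dO : measure_display)
    (Omega : measurableType dO) (P : probability Omega R) (n b : nat)
    (J : Omega -> {set 'I_n}) : Prop :=
  forall A : {set 'I_n}, measurable (J @^-1` [set A]) /\
    P (J @^-1` [set A]) = (if #|A| == b then ('C(n, b)%:R)^-1 else 0)%:E.

(* The coordinates have law N(0, s^2); their independence is part of
   independent_randomness. *)
Definition gaussian_coords (R : realType) (dO : measure_display)
    (Omega : measurableType dO) (P : probability Omega R) (d : nat) (s : R)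
    (xi : Omega -> 'rV[R]_d) : Prop :=
  forall j : 'I_d,
    measurable_fun [set: Omega] (fun om => xi om 0 j) /\
    forall U : set R, measurable U ->
      P ((fun om => xi om 0 j) @^-1` U) = centered_normal s U.

(* The K batches and the K * d noise coordinates are mutually independent;
   with gaussian_coords this gives independent noises of law N(0, s_k^2 I). *)
Definition independent_randomness (R : realType) (dO : measure_display)
    (Omega : measurableType dO) (P : probability Omega R) (n d K : nat)
    (J : nat -> Omega -> {set 'I_n}) (xi : nat -> Omega -> 'rV[R]_d) : Prop :=
  mutually_independent P
    (fun i : 'I_K + 'I_K * 'I_d =>
       match i with
       | inl k => [set E | exists C : set {set 'I_n}, E = J k.+1 @^-1` C]
       | inr (k, j) => [set E | exists2 U : set R, measurable U &
                                  E = (fun om => xi k.+1 om 0 j) @^-1` U]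
       end).

Definition borel_measurable (R : realType) (d : nat)
    (f : 'rV[R]_d -> 'rV[R]_d) : Prop :=
  measurable_fun [set: g_sigma_algebraType (@open 'rV[R]_d)]
    (f : g_sigma_algebraType (@open 'rV[R]_d) ->
         g_sigma_algebraType (@open 'rV[R]_d)).

(* Main.v *)
Require Import Defs.
From mathcomp Require Import all_boot all_order all_algebra.
From mathcomp Require Import all_classical all_reals all_analysis.
From mathcomp Require Import measurable_realfun ring lra.

(** Two runs on neighboring data sets, which differ at the position [i] only,
    use the same noises, so their iterates can only separate through the
    subproblem solver.  Each subproblem is a [lambda]-strongly monotone
    variational inequality: testing the inequality of either run at the solution
    of the other one and adding the two shows that the distance [a] of the two
    solutions satisfies [a^2 <= (b + e / lambda) a + 2 nu / lambda], where [b]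
    is the distance of the previous iterates and [e] bounds the difference of
    the two operators at one point; hence [a <= b + e / lambda + sqrt (2 nu /
    lambda)] ([prox_sol_stable]).  The operators of the two runs agree unless
    the batch contains [i], and they differ by at most [2 M / B_k] if it does.
    Adding up the steps, and since averaging and Euclidean projection do not
    expand distances, the stability gap is at most the sum over [k] of
    [1(i in J_k) 2 M / (B_k lambda_k) + sqrt (2 nu / lambda_k)]
    ([nispp_dist_stable]), as soon as every batch has its prescribed size, which
    happens almost surely.

    For the bound in expectation, a uniform batch of size [B_k] contains [i]
    with probability [B_k / n] ([uniform_batch_mem]).  The integral of the gap
    is compared to that of the pathwise bound straight from the definition of
    the integral as a supremum over simple functions
    ([ge0_le_integral_off_null]).

    For the bound in probability, the number of batches that contain [i] is
    binomial with mean [K B / n], by independence, and a Chernoff bound shows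
    that it exceeds twice its mean with probability at most
    [exp (- K B / (4 n))] ([binomial_chernoff]); a union bound over [i]
    concludes.  One event serves all pairs of data sets because it depends on
    the positions of the sampled points only. *)

Import Order.TTheory GRing.Theory Num.Theory.
Import numFieldNormedType.Exports.
Local Open Scope classical_set_scope.
Local Open Scope ring_scope.
Set Implicit Arguments.
Unset Strict Implicit.

(** * The Euclidean inner product and norm *)

Section Euclidean.
Variables (R : realType) (d : nat).
Implicit Types (u v w : 'rV[R]_d) (a : R).

Lemma dotC u v : dot u v = dot v u.
Proof. by apply: eq_bigr => j _; rewrite mulrC. Qed.

Lemma dotDl u v w : dot (u + v) w = dot u w + dot v w.
Proof. by rewrite -big_split/=; apply: eq_bigr => j _; rewrite mxE mulrDl. Qed.

Lemma dotZl a u v : dot (a *: u) v = a * dot u v.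
Proof. by rewrite mulr_sumr; apply: eq_bigr => j _; rewrite mxE mulrA. Qed.

Lemma dotNl u v : dot (- u) v = - dot u v.
Proof. by rewrite -scaleN1r dotZl mulN1r. Qed.

Lemma dotDr u v w : dot w (u + v) = dot w u + dot w v.
Proof. by rewrite dotC dotDl !(dotC w). Qed.

Lemma dotZr a u v : dot u (a *: v) = a * dot u v.
Proof. by rewrite dotC dotZl dotC. Qed.

Lemma dotNr u v : dot u (- v) = - dot u v.
Proof. by rewrite dotC dotNl dotC. Qed.

Lemma dot0l u : dot 0 u = 0.
Proof. by apply: big1 => j _; rewrite mxE mul0r. Qed.

Definition dotE := (dotDl, dotDr, dotZl, dotZr, dotNl, dotNr).

Lemma dot_ge0 u : 0 <= dot u u.
Proof. by apply: sumr_ge0 => j _; rewrite -expr2 sqr_ge0. Qed.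

Lemma dot_eq0 u : dot u u = 0 -> u = 0.
Proof.
move/psumr_eq0P => u0; apply/rowP => j; rewrite mxE.
have /eqP : u 0 j * u 0 j = 0 by apply: u0 => // i _; rewrite -expr2 sqr_ge0.
by rewrite mulf_eq0 => /orP[]/eqP.
Qed.

Lemma enorm_ge0 u : 0 <= enorm u.
Proof. exact: sqrtr_ge0. Qed.

Lemma enorm_sqr u : enorm u ^+ 2 = dot u u.
Proof. by rewrite sqr_sqrtr// dot_ge0. Qed.

Lemma enorm0 : enorm (0 : 'rV[R]_d) = 0.
Proof. by rewrite /enorm dot0l sqrtr0. Qed.

(** The square of the vector [|v| u - |u| v] is nonnegative and equals
    [2 |u| |v| (|u| |v| - <u, v>)]. *)
Lemma dot_le_enorm u v : dot u v <= enorm u * enorm v.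
Proof.
have [u0|u0] := eqVneq (enorm u) 0.
  have -> : u = 0 by apply: dot_eq0; rewrite -enorm_sqr u0 expr0n.
  by rewrite dot0l enorm0 mul0r.
have [v0|v0] := eqVneq (enorm v) 0.
  have -> : v = 0 by apply: dot_eq0; rewrite -enorm_sqr v0 expr0n.
  by rewrite dotC dot0l enorm0 mulr0.
have uv_gt0 : 0 < enorm u * enorm v by rewrite mulr_gt0 ?lt0r ?u0 ?v0 ?enorm_ge0.
have := dot_ge0 (enorm v *: u - enorm u *: v).
rewrite !dotE (dotC v u) -!enorm_sqr.
set a := enorm u in uv_gt0 *; set b := enorm v in uv_gt0 *; set c := dot u v => h.
rewrite -subr_ge0 -(pmulr_rge0 _ uv_gt0); nra.
Qed.

Lemma enormD u v : enorm (u + v) <= enorm u + enorm v.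
Proof.
rewrite -(@ler_pXn2r _ 2)// ?nnegrE ?addr_ge0 ?enorm_ge0//.
rewrite enorm_sqr !dotE (dotC v u) -!enorm_sqr.
by have := dot_le_enorm u v; lra.
Qed.

Lemma enormZ a u : enorm (a *: u) = `|a| * enorm u.
Proof.
by rewrite /enorm dotZl dotZr mulrA -expr2 sqrtrM ?sqr_ge0// sqrtr_sqr.
Qed.

Lemma enormN u : enorm (- u) = enorm u.
Proof. by rewrite -scaleN1r enormZ normrN1 mul1r. Qed.

Lemma enormB u v : enorm (u - v) <= enorm u + enorm v.
Proof. by rewrite -(enormN v) enormD. Qed.

Lemma enorm_sum (I : Type) (r : seq I) (p : pred I) (f : I -> 'rV[R]_d) :
  enorm (\sum_(i <- r | p i) f i) <= \sum_(i <- r | p i) enorm (f i).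
Proof.
elim/big_rec2 : _ => [|i y x _ h]; first by rewrite enorm0.
exact: le_trans (enormD _ _) (lerD (lexx _) h).
Qed.

Lemma dist_continuous (x : 'rV[R]_d) : continuous (fun y : 'rV[R]_d => enorm (x - y)).
Proof.
have c : continuous (fun y : 'rV[R]_d => dot (x - y) (x - y)).
  apply: continuous_big => [|j _ y]; first exact: add_continuous.
  have c : {for y, continuous (fun z : 'rV[R]_d => (x - z) 0 j)}.
    rewrite (_ : (fun _ => _) = (fun z : 'rV[R]_d => x 0 j - z 0 j)); last first.
      by apply/funext => z; rewrite !mxE.
    by apply: continuousB; [exact: cst_continuous|exact: coord_continuous].
  exact: continuousM.
by move=> y; exact: continuous_comp (c y) (@sqrt_continuous R _).
Qed.

(** * Euclidean projection onto a compact convex set *)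

Variable W : set 'rV[R]_d.
Hypothesis Wcompact : compact W.
Hypothesis Wconvex : convex_set W.

Lemma convex_segment u v a : 0 <= a -> a <= 1 -> W u -> W v ->
  W (u + a *: (v - u)).
Proof.
move=> a0 a1 Wu Wv.
have /set_mem := @Wconvex v u (Itv01 a0 a1) (mem_set Wv) (mem_set Wu).
rewrite /conv/= /unstable.onem.
by rewrite scalerBl scale1r scalerBr addrCA.
Qed.

(** Compactness provides a nearest point, so [xget] returns a genuine one and
    not its default value. *)
Lemma eprojP x : W !=set0 ->
  W (eproj W x) /\ forall z, W z -> enorm (x - eproj W x) <= enorm (x - z).
Proof.
move=> W0.
have [|y /set_mem Wy ymin] := @EVT_min_rV R d (fun y : 'rV[R]_d => enorm (x - y)) W W0 Wcompact.
  exact/continuous_subspaceT/dist_continuous.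
apply: (@xgetPex _ 0 [set y | W y /\ forall z, W z -> enorm (x - y) <= enorm (x - z)]).
by exists y; split => // z Wz; apply: ymin; exact/mem_set.
Qed.

(** The first-order optimality condition: otherwise moving the projection a
    little towards [z], inside [W], would bring it closer to [x]. *)
Lemma eproj_obtuse x z : W z -> dot (x - eproj W x) (z - eproj W x) <= 0.
Proof.
move=> Wz; have [Wy ymin] := @eprojP x (ex_intro _ z Wz).
set y := eproj W x in Wy ymin *.
set c := dot (x - y) (z - y); set q := dot (z - y) (z - y).
have key t : 0 <= t -> t <= 1 -> 2 * t * c <= t ^+ 2 * q.
  move=> t0 t1; have := ymin _ (convex_segment t0 t1 Wy Wz).
  move/(lerXn2r 2) => /(_ (enorm_ge0 _) (enorm_ge0 _)).
  rewrite !enorm_sqr opprD addrA !(dotDl (x - y), dotDr (x - y), dotDr (- _)).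
  by rewrite !(dotNl, dotNr, dotZl, dotZr) (dotC (z - y) (x - y)) -/c -/q; lra.
rewrite leNgt; apply/negP => c0.
have q0 : 0 <= q by exact: dot_ge0.
(* t |-> 2 t c - t^2 q is maximal at c / q; this t is smaller and at most 1 *)
pose t := c / (c + q).
have cq : 0 < c + q by lra.
have t0 : 0 < t by rewrite divr_gt0.
have t1 : t <= 1 by rewrite ler_pdivrMr// mul1r; lra.
have tE : t * (c + q) = c by rewrite mulfVK// gt_eqF.
have h := key t (ltW t0) t1; clearbody t.
have {h} : t * (2 * c) <= t * (t * q) by lra.
rewrite ler_pM2l// => h.
have tc0 : 0 < t * c by rewrite mulr_gt0.
lra.
Qed.

(** With [p] and [q] the projections of [u] and [v], adding the two obtuse angle
    conditions gives [|p - q|^2 <= <u - v, p - q>]; Cauchy-Schwarz does the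
    rest. *)
Lemma eproj_nonexpansive u v : W !=set0 ->
  enorm (eproj W u - eproj W v) <= enorm (u - v).
Proof.
move=> W0; have [Wp _] := eprojP u W0; have [Wq _] := eprojP v W0.
have := eproj_obtuse u Wq; have := eproj_obtuse v Wp.
set p := eproj W u; set q := eproj W v => h1 h2.
have : enorm (p - q) * enorm (p - q) <= enorm (u - v) * enorm (p - q).
  apply: le_trans (dot_le_enorm _ _).
  rewrite -expr2 enorm_sqr -subr_ge0.
  have -> : dot (u - v) (p - q) - dot (p - q) (p - q) =
      - dot (u - p) (q - p) - dot (v - q) (p - q).
    rewrite !dotE; lra.
  lra.
have [->|p0] := eqVneq (enorm (p - q)) 0; first by rewrite enorm_ge0.
by rewrite ler_pM2r// lt0r p0 enorm_ge0.
Qed.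

End Euclidean.

(** * Stability of the subproblems and of the iterates *)

Lemma le_of_quadratic (R : realType) (a h c : R) :
  0 <= h -> 0 <= c -> a * a <= h * a + c -> a <= h + Num.sqrt c.
Proof.
move=> h0 c0 ahc; rewrite leNgt; apply/negP => a_gt.
have s0 := sqrtr_ge0 c; have sE := sqr_sqrtr c0.
set s := Num.sqrt c in a_gt s0 sE.
have a0 : 0 < a by lra.
have : s * s < a * (a - h) by apply: ltr_pM => //; lra.
by move: sE; rewrite expr2; lra.
Qed.

(** The term [f u - g u'] splits into [f u - f u'], which monotonicity of [f]
    discards, and [f u' - g u'], the difference of the two operators at a
    single point. *)
Lemma prox_sol_stable (R : realType) (d : nat) (W : set 'rV[R]_d)
    (f g : 'rV[R]_d -> 'rV[R]_d) (lam nu e : R) (w w' u u' : 'rV[R]_d) :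
  0 < lam -> 0 <= nu -> emonotone_on W f ->
  prox_sol W f lam nu w u -> prox_sol W g lam nu w' u' ->
  enorm (f u' - g u') <= e ->
  enorm (u - u') <= enorm (w - w') + e / lam + Num.sqrt (2 * nu / lam).
Proof.
move=> lam0 nu0 fmono [Wu uP] [Wu' uP'] fge.
have e0 : 0 <= e by apply: le_trans fge; exact: enorm_ge0.
apply: le_of_quadratic.
- by rewrite addr_ge0 ?enorm_ge0// divr_ge0// ltW.
- by rewrite divr_ge0 ?mulr_ge0// ltW.
rewrite -(ler_pM2l lam0) -expr2 enorm_sqr.
have -> : lam * ((enorm (w - w') + e / lam) * enorm (u - u') + 2 * nu / lam) =
    lam * (enorm (w - w') * enorm (u - u')) + e * enorm (u - u') + 2 * nu.
  by field; rewrite gt_eqF.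
have h1 := uP _ Wu'; have h2 := uP' _ Wu; have h3 := fmono _ _ Wu Wu'.
have h4 := dot_le_enorm (f u' - g u') (u' - u).
have h5 := dot_le_enorm (w - w') (u - u').
have n0 := enorm_ge0 (u - u').
have h6 : enorm (f u' - g u') * enorm (u - u') <= e * enorm (u - u').
  exact: ler_wpM2r.
have h7 := ler_wpM2l (ltW lam0) h5.
rewrite -(enormN (u' - u)) opprB in h4.
move: h1 h2 h3 h4 h6 h7; rewrite !dotE; lra.
Qed.

Section Iterates.
Variables (R : realType) (d : nat) (W : set 'rV[R]_d).
Variables (Z : Type) (F : Z -> 'rV[R]_d -> 'rV[R]_d) (M : R) (n : nat).
Hypothesis Fmono : forall beta, emonotone_on W (F beta).
Hypothesis Fbnd : forall beta, ebounded_on W M (F beta).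

Lemma batch_op_monotone (S : n.-tuple Z) (J : {set 'I_n}) :
  emonotone_on W (batch_op F S J).
Proof.
move=> x y Wx Wy; rewrite /batch_op -scalerBr dotZl mulr_ge0 ?invr_ge0//.
rewrite -sumrB.
elim/big_rec : _ => [|i z _ z0]; first by rewrite dot0l.
by rewrite dotDl addr_ge0//; exact: Fmono.
Qed.

(** The two averages differ in the summand of [i] at most, and the values of [F]
    at the two entries there are each bounded by [M]. *)
Lemma batch_op_neighbors (S S' : n.-tuple Z) (i : 'I_n) (J : {set 'I_n}) u :
  W u -> (forall j, j != i -> tnth S j = tnth S' j) ->
  enorm (batch_op F S J u - batch_op F S' J u) <= (i \in J)%:R * (2 * M / #|J|%:R).
Proof.
move=> Wu SS'; rewrite /batch_op -scalerBr -sumrB enormZ.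
rewrite ger0_norm ?invr_ge0//.
have [iJ|iJ] := boolP (i \in J); last first.
  rewrite big1 ?enorm0 ?mulr0 ?mul0r// => j jJ.
  by rewrite SS' ?subrr//; apply: contraNneq iJ => <-.
rewrite mul1r mulrC ler_wpM2r ?invr_ge0// (bigD1 i)//= big1 ?addr0.
  apply: le_trans (enormB _ _) _.
  by rewrite mulr2n mulrDl mul1r lerD//; exact: Fbnd.
by move=> j /andP[_ ji]; rewrite SS'// subrr.
Qed.

Variables (lambda : nat -> R) (nu : R) (Bs : nat -> nat) (K : nat).
Variable solve : nat -> n.-tuple Z -> {set 'I_n} -> 'rV[R]_d -> 'rV[R]_d.
Hypothesis lambda_gt0 : forall k, (1 <= k <= K)%N -> 0 < lambda k.
Hypothesis nu_ge0 : 0 <= nu.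
Hypothesis solve_sol : forall k (S : n.-tuple Z) (J : {set 'I_n}) w,
  (1 <= k <= K)%N -> #|J| = Bs k ->
  prox_sol W (batch_op F S J) (lambda k) nu w (solve k S J w).

Variables (w0 : 'rV[R]_d) (J : nat -> {set 'I_n}) (xi : nat -> 'rV[R]_d).
Hypothesis J_size : forall k, (1 <= k <= K)%N -> #|J k| = Bs k.
Variables (S S' : n.-tuple Z) (i : 'I_n).
Hypothesis SS' : forall j, j != i -> tnth S j = tnth S' j.

(** How much step [k] can add to the distance of the two runs. *)
Definition step_gap k : R :=
  (i \in J k)%:R * (2 * M / ((Bs k)%:R * lambda k)) + Num.sqrt (2 * nu / lambda k).

(** The common noise cancels in the difference of the two iterates, so step [k]
    only adds the gap of its subproblem. *)
Lemma nispp_iter_stable k : (k <= K)%N ->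
  enorm (nispp_iter solve w0 J xi S k - nispp_iter solve w0 J xi S' k)
  <= \sum_(1 <= j < k.+1) step_gap j.
Proof.
elim: k => [|k IH] kK; first by rewrite big_nil subrr enorm0.
rewrite big_nat_recr//= -/(nispp_iter _ _ _ _ _ k).
set w := nispp_iter _ _ _ _ S k; set w' := nispp_iter _ _ _ _ S' k.
have k1 : (1 <= k.+1 <= K)%N by [].
have uP := @solve_sol _ S (J k.+1) w k1 (J_size k1).
have uP' := @solve_sol _ S' (J k.+1) w' k1 (J_size k1).
have := prox_sol_stable (lambda_gt0 k1) nu_ge0
  (batch_op_monotone S (J k.+1)) uP uP' (batch_op_neighbors _ uP'.1 SS').
rewrite opprD addrACA subrr addr0 => /le_trans; apply.
rewrite /step_gap addrA; apply: lerD => //; apply: lerD; first exact: IH (ltnW kK).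
by rewrite J_size// invfM !mulrA.
Qed.

Hypothesis M_ge0 : 0 <= M.

Lemma step_gap_ge0 k : (1 <= k <= K)%N -> 0 <= step_gap k.
Proof.
move=> /lambda_gt0/ltW k0.
by rewrite addr_ge0 ?sqrtr_ge0// mulr_ge0// divr_ge0 ?mulr_ge0.
Qed.

Hypotheses (Wcompact : compact W) (Wconvex : convex_set W) (W0 : W !=set0).
Variable gamma : nat -> R.
Hypothesis K_gt0 : (0 < K)%N.
Hypothesis gamma_gt0 : forall k, (1 <= k <= K)%N -> 0 < gamma k.

(** The weighted average of the iterates inherits the bound of the last one,
    since the bounds increase with the number of steps. *)
Lemma nispp_dist_stable :
  nispp_dist W solve w0 gamma K J xi S S' <= \sum_(1 <= k < K.+1) step_gap k.
Proof.
apply: le_trans (eproj_nonexpansive Wcompact Wconvex _ _ W0) _.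
rewrite -scalerBr -sumrB enormZ.
under [X in enorm X]eq_bigr do rewrite -scalerBr.
set G := \sum_(1 <= k < K.+1) gamma k.
have G0 : 0 < G.
  rewrite /G big_nat_recr//= ltr_wpDl ?gamma_gt0 ?K_gt0 ?leqnn//.
  rewrite big_nat_cond sumr_ge0// => k; rewrite andbT => /andP[k1 kK].
  by rewrite ltW// gamma_gt0// k1 ltnW.
rewrite ger0_norm; last by rewrite invr_ge0 ltW.
rewrite ler_pdivrMl// mulr_suml.
apply: le_trans (enorm_sum _ _ _) _.
rewrite [leLHS]big_nat_cond [leRHS]big_nat_cond; apply: ler_sum => k.
rewrite andbT ltnS => /andP[k1 kK].
have g0 : 0 <= gamma k by rewrite ltW// gamma_gt0// k1.
rewrite enormZ ger0_norm// ler_wpM2l//.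
apply: le_trans (nispp_iter_stable kK) _.
rewrite [leRHS](@big_cat_nat _ _ _ k.+1)//= ?ltnS// lerDl.
rewrite big_nat_cond sumr_ge0// => j; rewrite andbT ltnS => /andP[kj jK].
by apply: step_gap_ge0; rewrite jK andbT (leq_ltn_trans _ kj).
Qed.

End Iterates.

(** * Finite-valued random variables and the integral *)

Section Probability.
Variables (R : realType) (dO : measure_display) (Omega : measurableType dO).
Variable P : probability Omega R.

Lemma finite_law (T : finType) (X : Omega -> T) (Q : pred T) :
  (forall t, measurable (X @^-1` [set t])) ->
  measurable (X @^-1` [set t | Q t]) /\
  P (X @^-1` [set t | Q t]) = (\sum_(t | Q t) P (X @^-1` [set t]))%E.
Proof.
move=> mX.
have -> : X @^-1` [set t | Q t] = \bigcup_(t in [set` Q]) (X @^-1` [set t]).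
  apply/seteqP; split => [om Qom|om [t Qt]]; first by exists (X om).
  by rewrite /preimage/= => ->.
split.
  by rewrite bigcup_pred; exact: bigsetU_measurable.
rewrite measure_fin_bigcup//; last by move=> t s _ _ [om []]; rewrite /preimage/= => <- <-.
rewrite [RHS]bigfs ?index_enum_uniq// => t _; by rewrite mem_index_enum.
Qed.

Lemma probability_bigcup_le (T : finType) (A : T -> set Omega) :
  (forall t, measurable (A t)) ->
  measurable (\bigcup_(t in [set: T]) A t) /\
  (P (\bigcup_(t in [set: T]) A t) <= \sum_t P (A t))%E.
Proof.
move=> mA; rewrite (_ : [set: T] = [set` predT]) ?bigcup_pred; last first.
  by apply/seteqP; split.
split; first exact: bigsetU_measurable.
have [] // : measurable (\big[setU/set0]_(t in predT) A t) /\
  (P (\big[setU/set0]_(t in predT) A t) <= \sum_(t in predT) P (A t))%E.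
apply: (big_ind2 (fun B (x : \bar R) => measurable B /\ (P B <= x)%E)) => //.
- by rewrite measure0.
- move=> B x C y [mB Bx] [mC Cy]; split; first exact: measurableU.
  by apply: le_trans (measureU2 _ mB mC) _; exact: leeD.
Qed.

Import HBNNSimple.

(** Monotonicity of the integral for a function [f] that need not be measurable:
    its integral is the supremum of those of the simple functions below [f], and
    each of these is below [g] almost everywhere. *)
Lemma ge0_le_integral_off_null (f g : Omega -> \bar R) (N : set Omega) :
  measurable N -> P N = 0%E ->
  (forall om, 0 <= f om)%E -> (forall om, 0 <= g om)%E ->
  measurable_fun [set: Omega] g -> (forall om, ~ N om -> (f om <= g om)%E) ->
  (\int[P]_om f om <= \int[P]_om g om)%E.
Proof.
move=> mN N0 f0 g0 mg fg; rewrite ge0_integralTE//.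
apply: ge_ereal_sup => _ [h hf <-]; rewrite -integralT_nnsfun.
apply: ae_ge0_le_integral => //.
- by move=> om _; rewrite lee_fin; exact: fun_ge0.
- exact/measurable_EFinP/measurable_funP.
- exists N; split=> // om /= fgom; apply: contrapT => /fg fg_om; apply: fgom => _.
  exact: le_trans (hf om) fg_om.
Qed.

(** * Uniform batches *)

Lemma uniform_batch_size n b (J : Omega -> {set 'I_n}) : uniform_batch P b J ->
  measurable (J @^-1` [set A : {set 'I_n} | #|A| != b]) /\
  P (J @^-1` [set A : {set 'I_n} | #|A| != b]) = 0%E.
Proof.
move=> JU; have [mJ ->] := finite_law (fun A : {set 'I_n} => #|A| != b) (fun A => (JU A).1).
by split=> //; apply: big1 => A /negPf Ab; rewrite (JU A).2 Ab.
Qed.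

(** By Pascal's rule, as the draws that miss [i] are the draws from the other
    [n - 1] positions. *)
Lemma card_draws_mem n b (i : 'I_n) : (0 < b)%N ->
  #|[set A : {set 'I_n} | i \in A & #|A| == b]| = 'C(n.-1, b.-1).
Proof.
case: b => // b _; case: n i => [[]//|n] i.
have := cards_draws [set: 'I_n.+1] b.+1; have := cards_draws [set~ i] b.+1.
rewrite cardsT card_ord cardsC1 card_ord [n.+1.-1]/= => without_i.
rewrite -(cardsID [set A : {set 'I_n.+1} | i \in A]) binS addnC.
rewrite (_ : #|_ :\: _| = 'C(n, b.+1)); last first.
  rewrite -without_i; apply: eq_card => A; rewrite !inE finset.subsetT /=; congr andb.
  by rewrite -finset.disjoints_subset disjoint_sym disjoints1.
move/addnI => <-; apply: eq_card => A; rewrite !inE finset.subsetT /= andbC//.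
Qed.

Lemma uniform_batch_mem n b (J : Omega -> {set 'I_n}) (i : 'I_n) :
  uniform_batch P b J -> (1 <= b <= n)%N ->
  measurable (J @^-1` [set A : {set 'I_n} | i \in A]) /\
  P (J @^-1` [set A : {set 'I_n} | i \in A]) = (b%:R / n%:R)%:E.
Proof.
move=> JU /andP[b0 bn].
have [mJ ->] := finite_law (fun A : {set 'I_n} => i \in A) (fun A => (JU A).1).
split=> //; rewrite (eq_bigr _ (fun A _ => (JU A).2)) sumEFin; congr EFin.
rewrite -big_mkcondr/= sumr_const.
rewrite (_ : #|_| = 'C(n.-1, b.-1)); last first.
  by rewrite -(card_draws_mem i b0); apply: eq_card => A; rewrite inE.
have n0 : (0 < n)%N by exact: leq_trans bn.
have := mul_bin_diag n b.-1; rewrite prednK// => /(congr1 (fun k => k%:R : R)).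
rewrite !natrM => h.
have nR : n%:R != 0 :> R by rewrite pnatr_eq0 -lt0n.
have CR : 'C(n, b)%:R != 0 :> R by rewrite pnatr_eq0 -lt0n bin_gt0.
by rewrite -[LHS]mulr_natl; apply/eqP; rewrite eqr_div// -h mulrC.
Qed.

(** * Concentration of a sum of independent indicators *)

(** Mutual independence restricted to a subfamily, indexed through [f], in the
    form of a product over the whole index type of that subfamily. *)
Lemma independent_fibers (I I' : finType) (G : I -> set (set Omega))
    (f : I' -> I) (E : I' -> set Omega) :
  mutually_independent P G -> injective f -> (forall i, G (f i) (E i)) ->
  P (\bigcap_(i in [set: I']) E i) = (\prod_i P (E i))%E.
Proof.
move=> indep f_inj GE.
(* the event E i at the index f i; off the range of f its value is irrelevant *)
pose E' (j : I) : set Omega := [set om | forall i, f i = j -> E i om].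
have E'f i : E' (f i) = E i.
  apply/seteqP; split=> [om/= /(_ i erefl)//|om Eom k /f_inj ->//].
have -> : (\prod_i P (E i) = \prod_(j in f @: [set: I']%SET) P (E' j))%E.
  rewrite big_imset; last by move=> ? ? _ _ /f_inj.
  by apply: eq_big => [i|i _]; rewrite ?finset.in_setT ?E'f.
rewrite -indep; last by move=> _ /imsetP[i _ ->]; rewrite E'f.
congr (P _); apply/seteqP; split => [om Eom _ /= /imsetP[i _ ->]|om Eom i _].
  by rewrite E'f; exact: Eom.
by rewrite -E'f; apply: Eom; rewrite /= imset_f.
Qed.

(** The hypothesis on [P] says that the events [A k] are independent of common
    probability [p]: it gives the law of the random set of the [k] whose event
    occurs.  Writing [m] for the mean [K p], the Markov inequality for the
    exponential moment of order 1/2 bounds the tail beyond [2 m] by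
    [exp (- m) (1 + p (sqrt e - 1))^K <= exp (m (sqrt e - 2))], and
    [sqrt e <= 7 / 4]. *)
Lemma binomial_chernoff (K : nat) (p : R) (A : 'I_K -> set Omega) :
  0 <= p -> p <= 1 -> (forall k, measurable (A k)) ->
  (forall T : {set 'I_K},
    P (\bigcap_(k in [set: 'I_K]) (if k \in T then A k else ~` A k)) =
    (\prod_k (if k \in T then p else 1 - p))%:E) ->
  let B := [set om | 2 * (K%:R * p) < \sum_k (\1_(A k) om : R)] in
  measurable B /\ (P B <= (expR (- (K%:R * p / 4)))%:E)%E.
Proof.
move=> p0 p1 mA PA B.
pose X om : {set 'I_K} := [set k | om \in A k]%SET.
have XE T : X @^-1` [set T] =
    \bigcap_(k in [set: 'I_K]) (if k \in T then A k else ~` A k).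
  apply/seteqP; split => [om <- k _|om Aom].
    by rewrite inE; case: ifPn; rewrite ?inE// notin_setE.
  apply/setP => k; rewrite inE; have := Aom k I.
  by case: ifPn => _ Ak; [rewrite mem_set|apply: memNset].
have mX T : measurable (X @^-1` [set T]).
  rewrite XE; apply: fin_bigcap_measurable => // k _.
  by case: ifP => _; [|apply: measurableC]; exact: mA.
have XB : B = X @^-1` [set T : {set 'I_K} | 2 * (K%:R * p) < #|T|%:R].
  rewrite /B; apply: eq_set => om /=.
  suff -> : \sum_k (\1_(A k) om : R) = #|X om|%:R by [].
  rewrite -sum1_card natr_sum [RHS]big_mkcond/=; apply: eq_bigr => k _.
  by rewrite inE indicE; case: (om \in A k).
have [mB PB] := finite_law (fun T : {set 'I_K} => 2 * (K%:R * p) < #|T|%:R) mX.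
rewrite XB; split=> //; rewrite PB.
under eq_bigr do rewrite XE PA.
rewrite sumEFin lee_fin.
pose q := expR (2^-1 : R).
have q_le : q <= 7 / 4.
  (* 1 - x <= exp (- x) at x = 1/8 suffices: (8/7)^4 < 7/4 *)
  have h : 7 / 8 <= expR (- 8^-1 : R).
    by apply: le_trans (expR_ge1Dx _); lra.
  have h4 : q * expR (- 8^-1) ^+ 4 = 1.
    rewrite -expRM_natl -expRD -[RHS]expR0; congr expR; lra.
  have h5 : (7 / 8) ^+ 4 <= expR (- 8^-1 : R) ^+ 4.
    by apply: lerXn2r => //; rewrite nnegrE ?expR_ge0//; lra.
  have q0 : 0 < q by exact: expR_gt0.
  have : q * (7 / 8) ^+ 4 <= 1 by rewrite -[leRHS]h4 ler_pM2l.
  lra.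
(* on the summation range the factor e^((|T| - 2 m) / 2) is at least 1 *)
apply: (@le_trans _ _ (\sum_(T : {set 'I_K})
    expR (- (K%:R * p)) * \prod_k (if k \in T then q * p else 1 - p))).
  rewrite [leLHS]big_mkcond/=; apply: ler_sum => T _.
  have r0 : 0 <= \prod_k (if k \in T then p else 1 - p).
    by apply: prodr_ge0 => k _; case: ifP => _; lra.
  have -> : \prod_k (if k \in T then q * p else 1 - p) =
      q ^+ #|T| * \prod_k (if k \in T then p else 1 - p).
    have -> : q ^+ #|T| = \prod_k (if k \in T then q else 1).
      by rewrite -big_mkcond prodr_const.
    by rewrite -big_split/=; apply: eq_bigr => k _; case: ifP; rewrite ?mul1r.
  rewrite /q -expRM_natl [leRHS]mulrA -expRD; case: ifPn => [Tp|_].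
    by rewrite ler_peMl// -[leLHS]expR0 ler_expR; lra.
  by rewrite mulr_ge0// expR_ge0.
(* the sum over all sets T expands a K-th power *)
rewrite -mulr_sumr.
have <- : \prod_(k < K) (q * p + (1 - p)) =
    \sum_(T : {set 'I_K}) \prod_k (if k \in T then q * p else 1 - p).
  by rewrite bigA_distr.
rewrite prodr_const card_ord.
apply: (@le_trans _ _ (expR (- (K%:R * p)) * expR (K%:R * (p * (q - 1))))).
  rewrite ler_wpM2l ?expR_ge0// expRM_natl lerXn2r ?nnegrE ?expR_ge0//.
    by have := expR_gt0 (2^-1 : R); rewrite -/q => q0; nra.
  by apply: le_trans (expR_ge1Dx _); lra.
rewrite -expRD ler_expR.
have := ler_wpM2l (mulr_ge0 (ler0n R K) p0) q_le; lra.
Qed.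

End Probability.

(** * Randomness of the sampled batches *)

Section Sampling.
Variables (R : realType) (dO : measure_display) (Omega : measurableType dO).
Variable P : probability Omega R.

Lemma integral_indicator_sum (K : nat) (A : 'I_K -> set Omega) (p c s : 'I_K -> R) :
  (forall k, measurable (A k)) -> (forall k, P (A k) = (p k)%:E) ->
  (forall k, 0 <= c k) -> (forall k, 0 <= s k) ->
  let g om := \sum_k (c k * \1_(A k) om + s k) in
  measurable_fun [set: Omega] (EFin \o g) /\
  (\int[P]_om (g om)%:E)%E = (\sum_k (c k * p k + s k))%:E.
Proof.
move=> mA PA c0 s0 g.
have mc k : measurable_fun [set: Omega] (fun om => c k * \1_(A k) om : R).
  by apply: measurable_funM => //; exact: measurable_indic.
have mg k : measurable_fun [set: Omega] (fun om => c k * \1_(A k) om + s k : R).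
  exact: measurable_funD.
split; first by apply/measurable_EFinP; exact: measurable_sum.
under eq_integral do rewrite /g -sumEFin.
rewrite ge0_integral_sum//; last 2 first.
- by move=> k; apply/measurable_EFinP.
- by move=> k om _; rewrite lee_fin addr_ge0// mulr_ge0.
rewrite -sumEFin; apply: eq_bigr => k _.
under eq_integral do rewrite EFinD EFinM.
rewrite ge0_integralD//; last 3 first.
- by move=> om _; rewrite -EFinM lee_fin mulr_ge0.
- exact/measurable_EFinP.
- by move=> om _; rewrite lee_fin.
rewrite ge0_integralZl_EFin//; last by apply/measurable_EFinP; exact: measurable_indic.
rewrite integral_indic// setIT [X in (_ * X + _)%E]PA (integral_cst P measurableT (s k)%:E).
by rewrite [X in (_ + _ * X)%E]probability_setT mule1 EFinD EFinM.
Qed.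

Lemma batch_sizes_as n (K : nat) (b : 'I_K -> nat) (J : 'I_K -> Omega -> {set 'I_n}) :
  (forall k, uniform_batch P (b k) (J k)) ->
  let N := [set om | exists k, #|J k om| != b k] in
  measurable N /\ P N = 0%E.
Proof.
move=> JU N.
have NE : N = \bigcup_(k in [set: 'I_K])
    (J k @^-1` [set A : {set 'I_n} | #|A| != b k]).
  by apply/seteqP; split => [om [k kb]|om [k _ kb]]; exists k.
have [mN PN] := probability_bigcup_le P (fun k => (uniform_batch_size (JU k)).1).
rewrite NE; split=> //; apply/eqP; rewrite -measure_le0; apply: le_trans PN _.
by rewrite big1// => k _; exact: (uniform_batch_size (JU k)).2.
Qed.

(** For each position the hits are independent events of probability [B / n];
    the factor [n] is the union bound over the positions. *)
Lemma batch_hits_chernoff n d (K B : nat) (J : nat -> Omega -> {set 'I_n})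
    (xi : nat -> Omega -> 'rV[R]_d) :
  (1 <= B <= n)%N ->
  (forall k, (1 <= k <= K)%N -> uniform_batch P B (J k)) ->
  independent_randomness P K J xi ->
  let Bad := [set om | exists i : 'I_n,
    2 * (K%:R * (B%:R / n%:R)) < (\sum_(k < K) (i \in J k.+1 om)%:R : R)] in
  measurable Bad /\
  (P Bad <= (n%:R * expR (- (K%:R * B%:R / (4 * n%:R))))%:E)%E.
Proof.
move=> Bn JU indep Bad.
have /andP[B0 Bn'] := Bn.
have n0 : 0 < n%:R :> R by rewrite ltr0n (leq_trans B0).
pose p : R := B%:R / n%:R.
have p0 : 0 <= p by rewrite divr_ge0.
have p1 : p <= 1 by rewrite ler_pdivrMr// mul1r ler_nat.
pose A (i : 'I_n) (k : 'I_K) := J k.+1 @^-1` [set T : {set 'I_n} | i \in T].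
have JU' (k : 'I_K) : uniform_batch P B (J k.+1) by apply: JU; rewrite /= ltn_ord.
have mA i k : measurable (A i k) := (uniform_batch_mem i (JU' k) Bn).1.
have PA i k : P (A i k) = p%:E := (uniform_batch_mem i (JU' k) Bn).2.
have PT i (T : {set 'I_K}) :
    P (\bigcap_(k in [set: 'I_K]) (if k \in T then A i k else ~` A i k)) =
    (\prod_k (if k \in T then p else 1 - p))%:E.
  rewrite (independent_fibers (f := inl) indep); last 2 first.
  - by move=> k l [].
  - move=> k; case: ifP => _; first by exists [set T : {set 'I_n} | i \in T].
    by exists (~` [set T : {set 'I_n} | i \in T]).
  rewrite -prodEFin; apply: eq_bigr => k _.
  by case: ifP => _; rewrite ?probability_setC// PA.
have chern i := binomial_chernoff p0 p1 (mA i) (PT i).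
have BadE : Bad = \bigcup_(i in [set: 'I_n])
    [set om | 2 * (K%:R * p) < \sum_k (\1_(A i k) om : R)].
  have E i om : \sum_(k < K) (i \in J k.+1 om)%:R = \sum_k (\1_(A i k) om : R).
    apply: eq_bigr => k _; rewrite indicE; congr (nat_of_bool _)%:R.
    by apply/idP/idP => [h|/set_mem//]; exact/mem_set.
  apply/seteqP; split => [om [i]|om [i _ /=]].
    by rewrite E => h; exists i.
  by rewrite -E => h; exists i.
have [mB PB] := probability_bigcup_le P (fun i => (chern i).1).
rewrite BadE; split=> //; apply: le_trans PB _.
apply: (@le_trans _ _ (\sum_(i < n) (expR (- (K%:R * p / 4)))%:E)%E).
  by apply: lee_sum => i _; exact: (chern i).2.
rewrite sumEFin sumr_const card_ord -[X in X%:E]mulr_natl lee_fin.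
rewrite (_ : K%:R * p / 4 = K%:R * B%:R / (4 * n%:R))//.
by rewrite /p; field; rewrite gt_eqF.
Qed.

End Sampling.

(** * Stability of the sampling-with-replacement method *)

Unset Implicit Arguments.

Theorem theorem6p2 (R : realType) (d : nat) (W : set 'rV[R]_d)
    (Wcompact : compact W) (Wconvex : convex_set W) (Wdiam : 0 < diameter W)
    (Z : Type) (F : Z -> 'rV[R]_d -> 'rV[R]_d) (L M : R)
    (Fmono : forall beta, emonotone_on W (F beta))
    (Flip : forall beta, elipschitz_on W L (F beta))
    (Fbnd : forall beta, ebounded_on W M (F beta))
    (n K : nat) (K_gt0 : (0 < K)%N)
    (lambda gamma sigma : nat -> R) (nu : R) (Bs : nat -> nat)
    (lambda_gt0 : forall k, (1 <= k <= K)%N -> 0 < lambda k)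
    (gamma_gt0 : forall k, (1 <= k <= K)%N -> 0 < gamma k)
    (sigma_ge0 : forall k, (1 <= k <= K)%N -> 0 <= sigma k)
    (nu_ge0 : 0 <= nu)
    (Bs_le : forall k, (1 <= k <= K)%N -> (1 <= Bs k <= n)%N)
    (w0 : 'rV[R]_d) (Ww0 : W w0)
    (solve : nat -> n.-tuple Z -> {set 'I_n} -> 'rV[R]_d -> 'rV[R]_d)
    (solve_sol : forall k (S : n.-tuple Z) (J : {set 'I_n}) w,
      (1 <= k <= K)%N -> #|J| = Bs k ->
      prox_sol W (batch_op F S J) (lambda k) nu w (solve k S J w))
    (solve_meas : forall k (S : n.-tuple Z) (J : {set 'I_n}),
      (1 <= k <= K)%N -> #|J| = Bs k -> borel_measurable (solve k S J))
    (dO : measure_display) (Omega : measurableType dO)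
    (P : probability Omega R)
    (J : nat -> Omega -> {set 'I_n}) (xi : nat -> Omega -> 'rV[R]_d)
    (J_unif : forall k, (1 <= k <= K)%N -> uniform_batch P (Bs k) (J k))
    (xi_gauss : forall k, (1 <= k <= K)%N ->
      gaussian_coords P (sigma k) (xi k))
    (indep : independent_randomness P K J xi) :
  let delta (S S' : n.-tuple Z) (om : Omega) : R :=
    nispp_dist W solve w0 gamma K (fun k => J k om) (fun k => xi k om) S S' in
  (ereal_sup [set e | exists S S' : n.-tuple Z,
      neighbors S S' /\ e = ('E_P[delta S S'])%E]
   <= (\sum_(1 <= k < K.+1)
        (2 * M / (n%:R * lambda k) + Num.sqrt (4 * nu / lambda k)))%:E)%E
  /\
  (forall (B : nat) (lam : R),
    (forall k, (1 <= k <= K)%N -> Bs k = B /\ lambda k = lam) ->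
    exists2 G : set Omega, measurable G &
      ((1 - n%:R * expR (- (K%:R * B%:R / (4 * n%:R))))%:E <= P G)%E /\
      forall om, G om ->
        (ereal_sup [set e | exists S S' : n.-tuple Z,
            neighbors S S' /\ e = (delta S S' om)%:E]
         <= (4 * M * K%:R / (lam * n%:R)
             + K%:R * Num.sqrt (4 * nu / lam))%:E)%E).
Proof.
move=> delta.
have Jrange (k : 'I_K) : (1 <= k.+1 <= K)%N by rewrite /= ltn_ord.
have [mN PN] := batch_sizes_as (fun k : 'I_K => J_unif _ (Jrange k)).
set N := [set om | _] in mN PN.
(* the pathwise bound holds as soon as all batches have their prescribed size *)
have delta_le (S S' : n.-tuple Z) (i : 'I_n) om :
    (forall j, j != i -> tnth S j = tnth S' j) -> ~ N om ->
    delta S S' om <= \sum_(k < K)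
      (2 * M / ((Bs k.+1)%:R * lambda k.+1) * (i \in J k.+1 om)%:R +
       Num.sqrt (4 * nu / lambda k.+1)).
  move=> SS' Nom.
  have M_ge0 : 0 <= M by apply: le_trans (Fbnd (tnth S i) _ Ww0); exact: enorm_ge0.
  have J_size k : (1 <= k <= K)%N -> #|J k om| = Bs k.
    case: k => // k /= kK; apply/eqP/negPn/negP => h; apply: Nom.
    by exists (Ordinal kK).
  have := @nispp_dist_stable R d W Z F M n Fmono Fbnd lambda nu Bs K solve
    lambda_gt0 nu_ge0 solve_sol w0 (fun k => J k om) (fun k => xi k om) J_size
    S S' i SS' M_ge0 Wcompact Wconvex (ex_intro _ w0 Ww0) gamma K_gt0 gamma_gt0.
  move=> /le_trans; apply; rewrite big_add1 big_mkord; apply: ler_sum => k _.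
  have lam0 := lambda_gt0 _ (Jrange k).
  rewrite /step_gap mulrC lerD2l; apply: ler_wsqrtr.
  by rewrite ler_pM2r ?invr_gt0// ler_wpM2r// ler_nat.
split.
  apply: ge_ereal_sup => _ [S [S' [[i SS'] ->]]].
  have M_ge0 : 0 <= M by apply: le_trans (Fbnd (tnth S i) _ Ww0); exact: enorm_ge0.
  have n0 : 0 < n%:R :> R by rewrite ltr0n (leq_ltn_trans _ (ltn_ord i)).
  pose A (k : 'I_K) := J k.+1 @^-1` [set T : {set 'I_n} | i \in T].
  have mem k := uniform_batch_mem i (J_unif _ (Jrange k)) (Bs_le _ (Jrange k)).
  have c_ge0 (k : 'I_K) : 0 <= 2 * M / ((Bs k.+1)%:R * lambda k.+1).
    by rewrite divr_ge0 ?mulr_ge0// ltW// lambda_gt0.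
  have [mg gE] := integral_indicator_sum (A := A) (fun k => (mem k).1)
    (fun k => (mem k).2) c_ge0 (fun k : 'I_K => sqrtr_ge0 (4 * nu / lambda k.+1)).
  rewrite unlock; apply: le_trans (ge0_le_integral_off_null mN PN _ _ mg _) _.
  - by move=> om; rewrite lee_fin enorm_ge0.
  - move=> om; rewrite lee_fin sumr_ge0// => k _.
    by rewrite addr_ge0 ?sqrtr_ge0// mulr_ge0.
  - move=> om /(delta_le S S' i _ SS') h; rewrite lee_fin; apply: le_trans h _.
    apply: ler_sum => k _; rewrite indicE lerD2r ler_wpM2l// ler_nat.
    by case: (boolP (i \in J k.+1 om)) => // iJ; rewrite mem_set.
  rewrite gE lee_fin big_add1 big_mkord; apply: ler_sum => k _.
  rewrite lerD2r le_eqVlt; apply/orP; left; apply/eqP.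
  have /andP[B0 _] := Bs_le _ (Jrange k).
  have BR0 : 0 < (Bs k.+1)%:R :> R by rewrite ltr0n.
  have lam0 := lambda_gt0 _ (Jrange k).
  by field; rewrite !gt_eqF.
move=> B lam Blam.
have BE k : (1 <= k <= K)%N -> Bs k = B by move=> /Blam[].
have lamE k : (1 <= k <= K)%N -> lambda k = lam by move=> /Blam[].
have K1 : (1 <= 1 <= K)%N by [].
have Bn : (1 <= B <= n)%N by rewrite -(BE 1%N K1) Bs_le.
have JU k : (1 <= k <= K)%N -> uniform_batch P B (J k).
  by move=> kK; rewrite -(BE k kK); exact: J_unif.
have lam0 : 0 < lam by rewrite -(lamE 1%N K1) lambda_gt0.
have [mBad PBad] := batch_hits_chernoff Bn JU indep.
set Bad := [set om | _] in mBad PBad.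
have mG : measurable (N `|` Bad) by exact: measurableU.
exists (~` (N `|` Bad)); first exact: measurableC.
split.
  rewrite probability_setC// EFinB leeB//.
  by apply: le_trans (measureU2 _ mN mBad) _; rewrite [X in (X + _)%E]PN add0e.
move=> om /not_orP[Nom Badom]; apply: ge_ereal_sup => _ [S [S' [[i SS'] ->]]].
have M_ge0 : 0 <= M by apply: le_trans (Fbnd (tnth S i) _ Ww0); exact: enorm_ge0.
have hits : \sum_(k < K) (i \in J k.+1 om)%:R <= 2 * (K%:R * (B%:R / n%:R)) :> R.
  by rewrite leNgt; apply/negP => h; apply: Badom; exists i.
have /andP[B0 Bn'] := Bn.
have B0R : 0 < B%:R :> R by rewrite ltr0n.
have n0R : 0 < n%:R :> R by rewrite ltr0n (leq_trans B0).
rewrite lee_fin; apply: le_trans (delta_le _ _ _ _ SS' Nom) _.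
under eq_bigr => k _ do rewrite BE// lamE//.
rewrite big_split/= -mulr_sumr sumr_const card_ord -[X in _ + X]mulr_natl lerD2r.
have c_ge0 : 0 <= 2 * M / (B%:R * lam) by rewrite divr_ge0 ?mulr_ge0 // ltW.
apply: le_trans (ler_wpM2l c_ge0 hits) _.
rewrite le_eqVlt; apply/orP; left; apply/eqP.
by field; rewrite !gt_eqF.
Qed.
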